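(* Let $G$ be a group and $(\theta,\mathcal S)\in\mathsf{pA}(G,\mathsf{Sem})$ such that $D_x$ is an ideal of $S$ for all $x\in G$. Then $(\theta,\mathcal S)$ has a globalization in $\mathsf A(G,\mathsf{Sem})$ if and only if $$x(x^{-1}(su)t)=s\,x(x^{-1}(u)t)$$ for all $x\in G$, $u\in D_x$ and $s,t\in S$; here the displayed equality means $\theta_x(\theta_{x^{-1}}(su)\cdot t)=s\cdot\theta_x(\theta_{x^{-1}}(u)\cdot t)$.
   Context: A partial action of a group $G$ on a set $S$ is a partial map $\theta:G\times S\dashrightarrow S$ such that for all $x,y\in G$, $a\in S$: (i) $\theta(1,a)$ is defined and equals $a$; (ii) if $\theta(x,a)$ is defined, then $\theta(x^{-1},\theta(x,a))$ is defined and equals $a$; (iii) if $\theta(y,a)$ and $\theta(x,\theta(y,a))$ are defined, then $\theta(xy,a)$ is defined and equals $\theta(x,\theta(y,a))$. It is global if everywhere defined. One writes $xa$ or $x(a)$ for $\theta(x,a)$. The domain $D_x$ is $\{\theta(x,a)\mid a\in S,\ \theta(x,a)\text{ defined}\}$, and $\theta_x=\theta(x,-)$ is a bijection $D_{x^{-1}}\to D_x$. $\mathsf{Sem}$ is the variety of semigroups. $\mathsf{pA}(G,\mathsf{Sem})$ is the category of pairs $(\theta,\mathcal S)$ with $\mathcal S=(S,\cdot)$ a semigroup and $\theta$ a partial action of $G$ on the set $S$ such that every $D_x$ is a subsemigroup $\mathcal D_x$ of $\mathcal S$ and every $\theta_x:\mathcal D_{x^{-1}}\to\mathcal D_x$ is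 an isomorphism of semigroups. Morphisms $(\theta,\mathcal S)\to(\theta',\mathcal S')$ are semigroup homomorphisms $\varphi$ such that whenever $\theta(x,a)$ is defined, $\theta'(x,\varphi(a))$ is defined and equals $\varphi(\theta(x,a))$. $\mathsf A(G,\mathsf{Sem})$ is the full subcategory of pairs with global $\theta$. A globalization of $(\theta,\mathcal S)$ in $\mathsf A(G,\mathsf{Sem})$ is $(\vartheta,\mathcal T)\in\mathsf A(G,\mathsf{Sem})$ with an injective morphism $\iota:(\theta,\mathcal S)\to(\vartheta,\mathcal T)$ such that for all $x\in G$, $a\in S$: $\theta(x,a)$ is defined iff $\vartheta(x,\iota(a))\in\iota(S)$. Ideals are two-sided. *)

(* Defs.v *)
From HB Require Import structures.
From mathcomp Require Import all_boot monoid.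
From mathcomp Require Import classical_sets.

Set Implicit Arguments.
Unset Strict Implicit.
Unset Printing Implicit Defensive.

Local Open Scope classical_set_scope.
Local Open Scope group_scope.

(* A partial map is an option-valued function: [None] means "undefined".      *)
Record partial_action (G : groupType) (S : Type) := PartialAction {
  pact :> G -> S -> option S;
  pact_one : forall a : S, pact 1 a = Some a;
  pact_inv : forall (x : G) (a b : S),
    pact x a = Some b -> pact x^-1 b = Some a;
  pact_mul : forall (x y : G) (a b c : S),
    pact y a = Some b -> pact x b = Some c -> pact (x * y) a = Some c
}.

Definition pdom (G : groupType) (S : Type) (theta : partial_action G S)
    (x : G) : set S :=
  [set b | exists a : S, theta x a = Some b].

Definition is_global (G : groupType) (S : Type)
    (theta : partial_action G S) : Prop :=
  forall (x : G) (a : S), isSome (theta x a).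

(* Subsemigroups and ideals are allowed to be empty, since [pdom theta x] may *)
(* be: [theta x] can be nowhere defined.                                      *)
Definition is_subsemigroup (S : semigroupType) (A : set S) : Prop :=
  forall a b : S, A a -> A b -> A (a * b).

Definition is_ideal (S : semigroupType) (I : set S) : Prop :=
  forall s a : S, I a -> I (s * a) /\ I (a * s).

(* Objects of pA(G, Sem). By [pact_inv], [theta x] is always a bijection from *)
(* [pdom theta x^-1], which is where it is defined, onto [pdom theta x]; so   *)
(* it is an isomorphism of semigroups as soon as it is multiplicative.        *)
Record psem (G : groupType) := PSem {
  psem_sort :> semigroupType;
  psem_act : partial_action G psem_sort;
  psem_sub : forall x : G, is_subsemigroup (pdom psem_act x);
  psem_iso : forall (x : G) (a b a' b' : psem_sort),
    psem_act x a = Some a' -> psem_act x b = Some b' ->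
    psem_act x (a * b) = Some (a' * b')
}.

Definition is_psem_morphism (G : groupType) (X Y : psem G)
    (phi : {multiplicative X -> Y}) : Prop :=
  forall (x : G) (a b : X),
    psem_act X x a = Some b -> psem_act Y x (phi a) = Some (phi b).

Definition is_globalization (G : groupType) (X Y : psem G)
    (iota : {multiplicative X -> Y}) : Prop :=
  [/\ is_global (psem_act Y),
      is_psem_morphism iota,
      injective iota &
      forall (x : G) (a : X),
        isSome (psem_act X x a) <->
        exists2 t : Y, psem_act Y x (iota a) = Some t & range iota t].

Definition has_globalization (G : groupType) (X : psem G) : Prop :=
  exists (Y : psem G) (iota : {multiplicative X -> Y}), is_globalization iota.

(* x(x^-1(u) t), as a partially defined expression.                           *)
Definition conj_mulr (G : groupType) (X : psem G) (x : G) (u t : X) :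
    option X :=
  obind (fun v : X => psem_act X x (v * t)) (psem_act X x^-1 u).

Lemma conj_mulr_defined (G : groupType) (X : psem G) (x : G) (u t : X) :
  (forall y : G, is_ideal (pdom (psem_act X) y)) ->
  pdom (psem_act X) x u -> isSome (conj_mulr x u t).
Proof.
move=> idl [a xa]; rewrite /conj_mulr (pact_inv xa) /=.
have [|_ [b xb]] := idl x^-1 t a; first by exists u; exact: pact_inv xa.
by have := pact_inv xb; rewrite invgK => ->.
Qed.

(* Main.v *)
Require Import Defs.
From HB Require Import structures.
From mathcomp Require Import all_boot monoid.
From mathcomp Require Import classical_sets.
From Stdlib Require Import Relation_Operators.
From mathcomp Require Import boolp.

Local Open Scope group_scope.

(** Necessity of the identity is associativity: inside a globalization both
    sides are the threefold product of s, u and x(t), bracketed in the two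
    possible ways, and the embedding is injective.

    For sufficiency, first forget the multiplication: as a set with a partial
    action, S always embeds into the global G-set L of classes of pairs (x, a),
    a formal translate of a by x, where (x, a) and (y, b) are identified when
    y^-1 x carries a to b.  Two elements of L may be multiplied as soon as they
    lie in a common translate xS, and the result does not depend on x because
    each theta_x is multiplicative.  The free monoid on L modulo the relations
    that replace two multipliable neighbours by their product is then a monoid
    on which G acts, and it receives a homomorphism from S compatible with the
    actions.  Its being a monoid, and not only a semigroup, is harmless: the
    empty word is just an adjoined unit.

    The only question is whether distinct elements of L stay distinct in this
    quotient.  Reading the relations as length-decreasing rewriting rules, the
    only critical situation is a word a b c with a, b in xS and b, c in yS.
    As the domains are ideals, the intersection of xS and yS is an ideal of
    both, so (a b) c and a (b c) both make sense, and the displayed identity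
    for x^-1 y is exactly their equality ([letter_mulA]).  Hence rewriting has
    the diamond property ([step_diamond]); since a one-letter word cannot be
    rewritten, two equivalent letters are equal ([letter_inj]).  So S embeds, and
    the translate of a by x lies in the image of S only if it is already the
    letter of some b, that is, if theta_x carries a to b. *)

(** * Translates of the elements of the semigroup *)

Section Letters.
Set Implicit Arguments.
Unset Strict Implicit.
Unset Printing Implicit Defensive.
Local Open Scope quotient_scope.

Context (G : groupType) (X : psem G).
Local Notation theta := (psem_act X).

Lemma pact_invE (x : G) (a b : X) :
  theta x^-1 b = Some a -> theta x a = Some b.
Proof. by move=> xb; have := pact_inv xb; rewrite invgK. Qed.

Lemma pdomV (x : G) (a b : X) : theta x a = Some b -> pdom theta x^-1 a.
Proof. by move=> xa; exists b; exact: pact_inv xa. Qed.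

Lemma pdomP (x : G) (a : X) :
  pdom theta x^-1 a -> exists b, theta x a = Some b.
Proof. by case=> b /pact_invE xa; exists b. Qed.

Definition same_letter (p q : G * X) : bool :=
  theta (q.1^-1 * p.1) p.2 == Some q.2.

Lemma same_letter_refl : reflexive same_letter.
Proof. by case=> x a; rewrite /same_letter /= mulVg pact_one. Qed.

Lemma same_letter_sym : symmetric same_letter.
Proof.
suff sym p q : same_letter p q -> same_letter q p.
  by move=> p q; apply/idP/idP; exact: sym.
case: p q => [x a] [y b] /eqP /= xa; apply/eqP => /=.
by have := pact_inv xa; rewrite invgM invgK.
Qed.

Lemma same_letter_trans : transitive same_letter.
Proof.
case=> y b [x a] [z c] /eqP /= xy /eqP /= yz; apply/eqP => /=.
by have := pact_mul xy yz; rewrite mulgA mulgK.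
Qed.

Canonical same_letter_equiv :=
  EquivRel same_letter same_letter_refl same_letter_sym same_letter_trans.

(** The enveloping G-set of the partial action, as a mere set. *)
Definition letter := {eq_quot same_letter_equiv}.
HB.instance Definition _ := Choice.on letter.
HB.instance Definition _ := EqQuotient.on letter.

Definition translate (x : G) (a : X) : letter := \pi_letter (x, a).

Lemma translateP (l : letter) : exists x a, l = translate x a.
Proof. by elim/quotW: l => -[x a]; exists x, a. Qed.

Lemma eq_translate (x y : G) (a b : X) :
  translate x a = translate y b <-> theta (y^-1 * x) a = Some b.
Proof.
split=> [/eqquotP /eqP //|xy].
by apply/eqquotP/eqP.
Qed.

Definition letter_act (g : G) (l : letter) : letter :=
  translate (g * (repr l).1) (repr l).2.

Lemma letter_actE (g x : G) (a : X) :
  letter_act g (translate x a) = translate (g * x) a.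
Proof.
rewrite /letter_act; case E: (repr _) => [y b] /=.
have /eq_translate xy : translate y b = translate x a.
  by rewrite /translate -E reprK.
by apply/eq_translate; rewrite invgM mulgA mulgVK.
Qed.

Lemma letter_act1 (l : letter) : letter_act 1 l = l.
Proof. by have [x [a ->]] := translateP l; rewrite letter_actE mul1g. Qed.

Lemma letter_actM (g h : G) (l : letter) :
  letter_act g (letter_act h l) = letter_act (g * h) l.
Proof. by have [x [a ->]] := translateP l; rewrite !letter_actE mulgA. Qed.

(** The product of two letters is a partial operation, given by its graph: it
    is defined when both letters lie in a common translate of the semigroup. *)
Definition letter_mul (a b c : letter) : Prop :=
  exists x s t,
    [/\ a = translate x s, b = translate x t & c = translate x (s * t)].

Lemma letter_mulI (x : G) (s t : X) :
  letter_mul (translate x s) (translate x t) (translate x (s * t)).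
Proof. by exists x, s, t. Qed.

Lemma letter_mul_fun (a b c c' : letter) :
  letter_mul a b c -> letter_mul a b c' -> c = c'.
Proof.
move=> [x [s [t [-> -> ->]]]].
move=> [y [s' [t' [/eq_translate ss' /eq_translate tt' ->]]]].
by apply/eq_translate; exact: psem_iso.
Qed.

Lemma letter_mul_act (g : G) (a b c : letter) :
  letter_mul a b c ->
  letter_mul (letter_act g a) (letter_act g b) (letter_act g c).
Proof.
by move=> [x [s [t [-> -> ->]]]]; rewrite !letter_actE; exact: letter_mulI.
Qed.

Lemma map_letter_act1 (w : seq letter) : map (letter_act 1) w = w.
Proof. by rewrite (eq_map letter_act1) map_id. Qed.

Lemma map_letter_actM (g h : G) (w : seq letter) :
  map (letter_act g) (map (letter_act h) w) = map (letter_act (g * h)) w.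
Proof. by rewrite -map_comp; apply: eq_map => l; exact: letter_actM. Qed.

(** * Words in the letters, up to multiplication of neighbours *)

Inductive step : seq letter -> seq letter -> Prop :=
| step_mul a b c w : letter_mul a b c -> step (a :: b :: w) (c :: w)
| step_cons a w w' : step w w' -> step (a :: w) (a :: w').

Lemma step_catl (p w w' : seq letter) : step w w' -> step (p ++ w) (p ++ w').
Proof. by move=> ww'; elim: p => //= a p IHp; exact: step_cons. Qed.

Lemma step_catr (q w w' : seq letter) : step w w' -> step (w ++ q) (w' ++ q).
Proof.
elim=> [a b c r abc | a r r' _ IHr] /=; first exact: step_mul.
exact: step_cons.
Qed.

Lemma step_act (g : G) (w w' : seq letter) :
  step w w' -> step (map (letter_act g) w) (map (letter_act g) w').
Proof.
elim=> [a b c r abc | a r r' _ IHr] /=; last exact: step_cons.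
by apply: step_mul; exact: letter_mul_act.
Qed.

Definition word_conv : seq letter -> seq letter -> Prop :=
  clos_refl_sym_trans _ step.

Lemma word_conv_map (f : seq letter -> seq letter) :
  (forall w w', step w w' -> step (f w) (f w')) ->
  forall w w', word_conv w w' -> word_conv (f w) (f w').
Proof.
move=> f_step w w'.
elim=> {w w'} [w w' /f_step | w | w w' _ | w w' w'' _ IH1 _ IH2].
- exact: rst_step.
- exact: rst_refl.
- exact: rst_sym.
- exact: rst_trans IH1 IH2.
Qed.

Lemma word_conv_cat (u u' v v' : seq letter) :
  word_conv u u' -> word_conv v v' -> word_conv (u ++ v) (u' ++ v').
Proof.
move=> uu' vv'; apply: (@rst_trans _ _ _ (u' ++ v)).
  by apply: (word_conv_map (f := cat^~ v)) uu' => w w'; exact: step_catr.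
by apply: word_conv_map vv' => w w'; exact: step_catl.
Qed.

Lemma word_conv_act (g : G) (w w' : seq letter) :
  word_conv w w' -> word_conv (map (letter_act g) w) (map (letter_act g) w').
Proof. by apply: word_conv_map; exact: step_act. Qed.

(** A boolean form of [word_conv], as the quotient construction requires. *)
Definition word_equiv (w w' : seq letter) : bool := `[< word_conv w w' >].

Lemma word_equiv_refl : reflexive word_equiv.
Proof. by move=> w; apply/asboolP; exact: rst_refl. Qed.

Lemma word_equiv_sym : symmetric word_equiv.
Proof. by move=> w w'; apply/asboolP/asboolP; exact: rst_sym. Qed.

Lemma word_equiv_trans : transitive word_equiv.
Proof.
by move=> v u w /asboolP uv /asboolP vw; apply/asboolP; exact: rst_trans uv vw.
Qed.

Canonical word_equiv_equiv :=
  EquivRel word_equiv word_equiv_refl word_equiv_sym word_equiv_trans.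

(** The quotient of the free monoid on the letters; it exists, with its action,
    for every partial action, but the semigroup need not embed in it. *)
Definition envelope := {eq_quot word_equiv_equiv}.
HB.instance Definition _ := Choice.on envelope.
HB.instance Definition _ := EqQuotient.on envelope.

Definition word_class (w : seq letter) : envelope := \pi_envelope w.

Lemma eq_word_class (w w' : seq letter) :
  word_class w = word_class w' <-> word_conv w w'.
Proof.
split=> [/eqquotP /asboolP //|ww'].
by apply/eqquotP/asboolP.
Qed.

Lemma word_classP (t : envelope) : exists w, t = word_class w.
Proof. by elim/quotW: t => w; exists w. Qed.

Lemma conv_repr (w : seq letter) : word_conv (repr (word_class w)) w.
Proof. by apply/eq_word_class; rewrite /word_class reprK. Qed.

Definition envelope_mul (t u : envelope) : envelope :=
  word_class (repr t ++ repr u).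

Lemma envelope_mulE (v w : seq letter) :
  envelope_mul (word_class v) (word_class w) = word_class (v ++ w).
Proof. by apply/eq_word_class/word_conv_cat; exact: conv_repr. Qed.

Lemma envelope_mulA : associative envelope_mul.
Proof.
move=> t u v; have [[w1 ->] [w2 ->] [w3 ->]] :=
  And3 (word_classP t) (word_classP u) (word_classP v).
by rewrite !envelope_mulE catA.
Qed.

HB.instance Definition _ := isSemigroup.Build envelope envelope_mulA.

Lemma word_classM (v w : seq letter) :
  word_class v * word_class w = word_class (v ++ w).
Proof. exact: envelope_mulE. Qed.

(** * The action on the quotient and the map from the semigroup to it *)

Definition envelope_map (g : G) (t : envelope) : envelope :=
  word_class (map (letter_act g) (repr t)).

Lemma envelope_mapE (g : G) (w : seq letter) :
  envelope_map g (word_class w) = word_class (map (letter_act g) w).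
Proof. by apply/eq_word_class/word_conv_act; exact: conv_repr. Qed.

Lemma envelope_map1 (t : envelope) : envelope_map 1 t = t.
Proof.
by have [w ->] := word_classP t; rewrite envelope_mapE map_letter_act1.
Qed.

Lemma envelope_map_comp (g h : G) (t : envelope) :
  envelope_map g (envelope_map h t) = envelope_map (g * h) t.
Proof.
by have [w ->] := word_classP t; rewrite !envelope_mapE map_letter_actM.
Qed.

Lemma envelope_mapM (g : G) (t u : envelope) :
  envelope_map g (t * u) = envelope_map g t * envelope_map g u.
Proof.
have [[v ->] [w ->]] := conj (word_classP t) (word_classP u).
by rewrite word_classM !envelope_mapE word_classM map_cat.
Qed.

Definition envelope_pact (g : G) (t : envelope) : option envelope :=
  Some (envelope_map g t).

Lemma envelope_pact1 (t : envelope) : envelope_pact 1 t = Some t.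
Proof. by rewrite /envelope_pact envelope_map1. Qed.

Lemma envelope_pactV (g : G) (t u : envelope) :
  envelope_pact g t = Some u -> envelope_pact g^-1 u = Some t.
Proof.
by case=> <-; rewrite /envelope_pact envelope_map_comp mulVg envelope_map1.
Qed.

Lemma envelope_pactM (g h : G) (t u v : envelope) :
  envelope_pact h t = Some u -> envelope_pact g u = Some v ->
  envelope_pact (g * h) t = Some v.
Proof. by case=> <- [<-]; rewrite /envelope_pact envelope_map_comp. Qed.

Definition envelope_act : partial_action G envelope :=
  PartialAction envelope_pact1 envelope_pactV envelope_pactM.

Lemma envelope_sub (g : G) : is_subsemigroup (pdom envelope_act g).
Proof.
move=> t u _ _; exists (envelope_map g^-1 (t * u)).
by rewrite /= /envelope_pact envelope_map_comp mulgV envelope_map1.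
Qed.

Lemma envelope_iso (g : G) (t u t' u' : envelope) :
  envelope_act g t = Some t' -> envelope_act g u = Some u' ->
  envelope_act g (t * u) = Some (t' * u').
Proof. by move=> [<-] [<-]; rewrite /= /envelope_pact envelope_mapM. Qed.

Definition envelope_psem : psem G := PSem envelope_sub envelope_iso.

Definition envelope_inj (a : X) : envelope_psem :=
  word_class [:: translate 1 a].

Lemma envelope_injM : {morph envelope_inj : a b / a * b >-> a * b}.
Proof.
move=> a b; rewrite /envelope_inj [RHS]word_classM /=.
apply/esym/eq_word_class/rst_step/step_mul; exact: letter_mulI.
Qed.

HB.instance Definition _ :=
  isMultiplicative.Build X envelope_psem envelope_inj envelope_injM.

Lemma envelope_act_inj (x : G) (a : X) :
  psem_act envelope_psem x (envelope_inj a) =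
    Some (word_class [:: translate x a]).
Proof. by rewrite /= /envelope_pact envelope_mapE /= letter_actE mulg1. Qed.

(** * Confluence *)

Section Confluence.

Hypothesis idl : forall x : G, is_ideal (pdom theta x).
Hypothesis conj_mulrA : forall (x : G) (u s t : X), pdom theta x u ->
  conj_mulr x (s * u) t = omap (fun w : X => s * w) (conj_mulr x u t).

(** With a and b in xS, b and c in yS, set z = x^-1 y and work in the chart xS:
    there a and b are s and u, with u in D_z, and c is the formal element z(t).
    The two bracketings are then z(z^-1(s u) t) and s z(z^-1(u) t). *)
Lemma letter_mulA (a b c ab bc : letter) :
  letter_mul a b ab -> letter_mul b c bc ->
  exists2 e, letter_mul ab c e & letter_mul a bc e.
Proof.
move=> [x [s [u [-> -> ->]]]] [y [v [t [/eq_translate uv -> ->]]]].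
pose z := x^-1 * y; have zV : z^-1 = y^-1 * x by rewrite invgM invgK.
rewrite -zV in uv.
have Du : pdom theta z u by exists v; exact: pact_invE.
have [v' suv'] : exists v', theta z^-1 (s * u) = Some v'.
  by apply: pdomP; rewrite invgK; have [] := idl s Du.
have [w vtw] : exists w, theta z (v * t) = Some w.
  by apply: pdomP; have [] := idl t (pdomV (pact_invE uv)).
have v'tsw : theta z (v' * t) = Some (s * w).
  by have := conj_mulrA s t Du; rewrite /conj_mulr uv suv' /= vtw.
exists (translate y (v' * t)).
  have -> : translate x (s * u) = translate y v'.
    by apply/eq_translate; rewrite -zV.
  exact: letter_mulI.
have -> : translate y (v * t) = translate x w by exact/eq_translate.
have -> : translate y (v' * t) = translate x (s * w) by exact/eq_translate.
exact: letter_mulI.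
Qed.

(** Two redexes of a word coincide, overlap in one letter or are disjoint;
    [letter_mulA] settles the overlap. *)
Lemma step_diamond (w w1 w2 : seq letter) :
  step w w1 -> step w w2 -> w1 = w2 \/ exists2 w3, step w1 w3 & step w2 w3.
Proof.
move=> ww1; elim: ww1 w2 => {w w1} [a b c w abc | a w w1 ww1 IH] w2 ww2.
- inversion ww2 as [? ? c' ? abc' | ? ? w' bw]; subst.
    by left; rewrite (letter_mul_fun abc abc').
  right; inversion bw as [? d e r bde | ? ? r wr]; subst.
    have [f cdf aef] := letter_mulA abc bde.
    by exists (f :: r); exact: step_mul.
  by exists (c :: r); [exact: step_cons | exact: step_mul].
- inversion ww2 as [? b c r abc | ? ? w' ww']; subst.
    right; inversion ww1 as [? d e r' bde | ? ? r' rr']; subst.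
      have [f cdf aef] := letter_mulA abc bde.
      by exists (f :: r'); exact: step_mul.
    by exists (c :: r'); [exact: step_mul | exact: step_cons].
  have [->|[w3 w13 w23]] := IH _ ww'; first by left.
  by right; exists (a :: w3); exact: step_cons.
Qed.

Inductive reduces_to (a : letter) : seq letter -> Prop :=
| reduces_letter : reduces_to a [:: a]
| reduces_step w w' : step w w' -> reduces_to a w' -> reduces_to a w.

Lemma letter_irreducible (a : letter) (w : seq letter) : ~ step [:: a] w.
Proof. by move=> aw; inversion aw as [|? ? ? nilw]; inversion nilw. Qed.

(** By the diamond, every step away from a reduction to a letter can be completed
    to that letter again: the letter cannot be left behind, since it is
    irreducible. *)
Lemma step_reduces (a : letter) (w w' : seq letter) :
  step w w' -> reduces_to a w -> reduces_to a w'.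
Proof.
move=> ww' wa; elim: wa w' ww' => {w} [w' /letter_irreducible //|].
move=> w v wv va IH w' ww'.
have [<- // | [u vu w'u]] := step_diamond wv ww'.
exact: reduces_step w'u (IH _ vu).
Qed.

(** So reducing to a given letter is an invariant of equivalence classes of words;
    it is what tells the classes of distinct letters apart. *)
Lemma conv_reduces (a : letter) (w w' : seq letter) :
  word_conv w w' -> reduces_to a w <-> reduces_to a w'.
Proof.
elim=> {w w'} [w w' ww' | w | w w' _ | w w' w'' _ IH1 _ IH2] //.
- by split=> [|w'a]; [exact: step_reduces | exact: reduces_step ww' w'a].
- by move=> IH; split=> /IH.
- by split=> [/IH1/IH2 | /IH2/IH1].
Qed.

Lemma letter_inj (a b : letter) :
  word_class [:: a] = word_class [:: b] -> a = b.
Proof.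
move=> /eq_word_class /(conv_reduces b) [_ /(_ (reduces_letter b)) ab].
by inversion ab as [|? w aw]; last have := letter_irreducible aw.
Qed.

Lemma envelope_globalization : is_globalization envelope_inj.
Proof.
split=> [//|x a b ab|a b|x a].
- rewrite envelope_act_inj /=; congr (Some (word_class [:: _])).
  by apply/eq_translate; rewrite invg1 mul1g.
- by move/letter_inj/eq_translate; rewrite mulVg pact_one => -[].
split=> [|[t]].
  case xa : (theta x a) => [b|] // _; rewrite envelope_act_inj.
  exists (word_class [:: translate x a]) => //; exists b => //.
  congr word_class; congr [:: _].
  by apply/esym/eq_translate; rewrite invg1 mul1g.
rewrite envelope_act_inj => -[<-] [b _ /letter_inj/esym/eq_translate].
by rewrite invg1 mul1g => ->.
Qed.

End Confluence.

End Letters.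

(** * Existence of a globalization *)

Theorem theorem5p1 (G : groupType) (X : psem G)
    (idl : forall x : G, is_ideal (pdom (psem_act X) x)) :
  has_globalization X <->
  (forall (x : G) (u s t : X), pdom (psem_act X) x u ->
     conj_mulr x (s * u) t =
       omap (fun w : X => s * w) (conj_mulr x u t)).
Proof.
split=> [[Y [iota [glob iota_mor iota_inj _]]] | conj_mulrA]; last first.
  exists (envelope_psem X), (@envelope_inj G X).
  exact: envelope_globalization.
move=> x u s t Du.
have := glob x (iota t).
case xt : (psem_act Y x (iota t)) => [y|] // _.
(* Whatever its first factor, the expression x(x^-1(v) t) is iota v times
   x(iota t) in the globalization. *)
have iota_conj v : pdom (psem_act X) x v ->
    exists2 w, conj_mulr x v t = Some w & iota w = iota v * y.
  move=> Dv; have := conj_mulr_defined t idl Dv; rewrite /conj_mulr.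
  case xv : (psem_act X x^-1 v) => [v'|] //=.
  case xv't : (psem_act X x (v' * t)) => [w|] // _; exists w => //.
  have := iota_mor _ _ _ xv't.
  rewrite gmulfM (psem_iso (iota_mor _ _ _ (pact_invE xv)) xt).
  by case.
have [w -> wE] := iota_conj u Du.
have [|w' -> w'E] := iota_conj (s * u); first by have [] := idl x s u Du.
congr Some; apply: iota_inj.
by rewrite w'E !gmulfM wE mulgA.
Qed.
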